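(* Suppose we are given a width-$W$ monotone XOS function $f$ on an $n$-element ground set $X$ explicitly in its max-of-sums representation, activation probabilities $(p_e)_{e\in X}$, and an oracle that, given a non-negative linear function $\mathbf{a}:X\to\mathbb{R}_{\ge0}$, returns a feasible sequence $S$ of the prefix-closed probing constraint $\mathcal{F}$ maximizing $\sum_{e\in S}\mathbf{a}(e)$. Then there is an algorithm running in time $\mathrm{poly}(n,W)$ (with oracle calls) that outputs a non-adaptive strategy whose expected value is at least an $\Omega(1/\log W)$-fraction of the expected value of the optimal adaptive strategy.
   Context: A function $f:2^X\to\mathbb{R}_{\ge0}$ is monotone XOS of width $W$ if $f(S)=\max_{i=1}^{W}\sum_{e\in S}\mathbf{a}_i(e)$ for vectors $\mathbf{a}_i\in\mathbb{R}_{\ge0}^X$. Stochastic probing: each $e\in X$ is active independently with probability $p_e$, revealed upon probing. $\mathcal{F}$ is a family of sequences of distinct elements closed under taking prefixes. An adaptive strategy is a binary decision tree (nodes labelled by elements, yes/no arcs by activity, no repeated elements on a path, every root-leaf sequence in $\mathcal{F}$) receiving $f(A)$ for the set $A$ of observed active elements at the leaf. A non-adaptive strategy is a fixed sequence $\sigma\in\mathcal{F}$ with value $\mathbb{E}[f(A\cap\sigma)]$, $A$ the random active set. *)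

(* Defs.v *)
From HB Require Import structures.
From mathcomp Require Import all_boot all_order all_algebra.
From mathcomp Require Import all_classical all_reals.
From mathcomp Require Import exp.
Set Implicit Arguments.
Unset Strict Implicit.
Unset Printing Implicit Defensive.
Import Order.TTheory GRing.Theory Num.Theory.
Local Open Scope ring_scope.

(* For W > 0 the default value 0 of the iterated max is harmless, since all
   the sums are nonnegative. *)
Definition xos_representation (R : realType) (X : finType) (W : nat)
    (a : 'I_W -> X -> R) (f : {set X} -> R) : Prop :=
  (forall i e, 0 <= a i e) /\
  (forall S : {set X}, f S = \big[Num.max/0]_(i < W) \sum_(e in S) a i e).

Definition activation_probability (R : realType) (X : finType) (p : X -> R)
    : Prop :=
  forall e, 0 <= p e <= 1.

Definition active_prob (R : realType) (X : finType) (p : X -> R)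
    (A : {set X}) : R :=
  (\prod_(e in A) p e) * (\prod_(e in ~: A) (1 - p e)).

Definition active_expectation (R : realType) (X : finType) (p : X -> R)
    (g : {set X} -> R) : R :=
  \sum_(A : {set X}) active_prob p A * g A.

Definition probing_constraint (X : finType) (F : seq X -> Prop) : Prop :=
  (forall s, F s -> uniq s) /\
  (forall s1 s2, prefix s1 s2 -> F s2 -> F s1).

Definition nonadaptive_value (R : realType) (X : finType) (p : X -> R)
    (f : {set X} -> R) (sigma : seq X) : R :=
  active_expectation p (fun A => f (A :&: [set e in sigma])).

Inductive dtree (X : Type) : Type :=
| Leaf
| Probe (e : X) (no yes : dtree X).
Arguments Leaf {X}.

Fixpoint branches (X : Type) (T : dtree X) : seq (seq X) :=
  match T with
  | Leaf => [:: [::]]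
  | Probe e no yes => [seq e :: s | s <- branches no ++ branches yes]
  end.

Definition adaptive_strategy (X : finType) (F : seq X -> Prop) (T : dtree X)
    : Prop :=
  forall s, s \in branches T -> uniq s /\ F s.

Fixpoint observed (X : finType) (T : dtree X) (A : {set X}) : {set X} :=
  match T with
  | Leaf => finset.set0
  | Probe e no yes =>
      if e \in A then e |: observed yes A else observed no A
  end.

Definition adaptive_value (R : realType) (X : finType) (p : X -> R)
    (f : {set X} -> R) (T : dtree X) : R :=
  active_expectation p (fun A => f (observed T A)).

(* [sup] is a junk value on unbounded sets; [adaptive_value_le_opt] below
   shows that this does not occur for XOS functions. *)
Definition adaptive_opt (R : realType) (X : finType) (F : seq X -> Prop)
    (p : X -> R) (f : {set X} -> R) : R :=
  sup [set adaptive_value p f T | T in adaptive_strategy F]%classic.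

Definition linear_oracle (R : realType) (X : finType) (F : seq X -> Prop)
    (orc : (X -> R) -> seq X) : Prop :=
  forall a : X -> R, (forall e, 0 <= a e) ->
    F (orc a) /\
    (forall s, F s -> \sum_(e <- s) a e <= \sum_(e <- orc a) a e).

(* Equal to log_2 W for W >= 2, and to 1 (instead of 0) for W = 1. *)
Definition log2_width (R : realType) (W : nat) : R :=
  Num.max 1 (ln W%:R / ln 2).

(* A real RAM with oracle calls.  The memory consists of arrays of naturals
   and arrays of reals; array names are literals of the program text, array
   indices are computed.  Natural numbers only have addition and truncated
   subtraction (no multiplication or shift, so that values stay of length
   linear in the running time); reals have exact field operations and
   comparison but no rounding, and cannot be converted to naturals.  The only
   constants are natural numbers, so a program carries no real data. *)

Inductive nexp : Type :=
| NConst (k : nat)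
| NGet (arr : nat) (idx : nexp)
| NAdd (x y : nexp)
| NSub (x y : nexp).

Inductive rexp : Type :=
| RConst (k : nat)
| RGet (arr : nat) (idx : nexp)
| RAdd (x y : rexp)
| RSub (x y : rexp)
| RMul (x y : rexp)
| RDiv (x y : rexp).

Inductive bexp : Type :=
| NLe (x y : nexp)
| RLe (x y : rexp)
| BNot (b : bexp).

Inductive cmd : Type :=
| Skip
| NSet (arr : nat) (idx x : nexp)
| RSet (arr : nat) (idx : nexp) (x : rexp)
| Seq (c1 c2 : cmd)
| If (b : bexp) (c1 c2 : cmd)
| While (b : bexp) (c : cmd)
| Query (qarr resarr : nat).

Record state (R : Type) : Type := State {
  nmem : nat -> nat -> nat;
  rmem : nat -> nat -> R
}.

Definition upd (T : Type) (m : nat -> nat -> T) (arr idx : nat) (v : T)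
    : nat -> nat -> T :=
  fun arr' idx' => if (arr' == arr) && (idx' == idx) then v else m arr' idx'.

Fixpoint neval (R : Type) (s : state R) (x : nexp) : nat :=
  match x with
  | NConst k => k
  | NGet arr idx => nmem s arr (neval s idx)
  | NAdd x y => (neval s x + neval s y)%N
  | NSub x y => (neval s x - neval s y)%N
  end.

Fixpoint reval (R : realType) (s : state R) (x : rexp) : R :=
  match x with
  | RConst k => k%:R
  | RGet arr idx => rmem s arr (neval s idx)
  | RAdd x y => reval s x + reval s y
  | RSub x y => reval s x - reval s y
  | RMul x y => reval s x * reval s y
  | RDiv x y => reval s x / reval s y
  end.

Fixpoint beval (R : realType) (s : state R) (b : bexp) : bool :=
  match b with
  | NLe x y => (neval s x <= neval s y)%N
  | RLe x y => reval s x <= reval s y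
  | BNot b => ~~ beval s b
  end.

(* A sequence of elements of 'I_n is stored preceded by its length. *)
Definition seq_code (n : nat) (sigma : seq 'I_n) : seq nat :=
  size sigma :: [seq nat_of_ord e | e <- sigma].

Definition query_answer (R : realType) (n : nat)
    (orc : ('I_n -> R) -> seq 'I_n) (s : state R) (qarr resarr : nat)
    : state R :=
  let code := seq_code (orc (fun e => rmem s qarr e)) in
  State
    (fun arr idx => if (arr == resarr) && (idx < size code)%N
                    then nth 0%N code idx else nmem s arr idx)
    (rmem s).

(* [exec orc c s t s']: started in s, c halts in s' after t steps.  A step is
   an assignment, a test or an oracle call; counting expression nodes instead
   would only change t by a constant factor depending on the program. *)
Inductive exec (R : realType) (n : nat) (orc : ('I_n -> R) -> seq 'I_n) :
    cmd -> state R -> nat -> state R -> Prop :=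
| exec_skip s :
    exec orc Skip s 1 s
| exec_nset arr idx x s :
    exec orc (NSet arr idx x) s 1
      (State (upd (nmem s) arr (neval s idx) (neval s x)) (rmem s))
| exec_rset arr idx x s :
    exec orc (RSet arr idx x) s 1
      (State (nmem s) (upd (rmem s) arr (neval s idx) (reval s x)))
| exec_seq c1 c2 s s1 s2 t1 t2 :
    exec orc c1 s t1 s1 -> exec orc c2 s1 t2 s2 ->
    exec orc (Seq c1 c2) s (t1 + t2)%N s2
| exec_if_true b c1 c2 s s1 t :
    beval s b -> exec orc c1 s t s1 -> exec orc (If b c1 c2) s t.+1 s1
| exec_if_false b c1 c2 s s1 t :
    ~~ beval s b -> exec orc c2 s t s1 -> exec orc (If b c1 c2) s t.+1 s1
| exec_while_true b c s s1 s2 t1 t2 :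
    beval s b -> exec orc c s t1 s1 -> exec orc (While b c) s1 t2 s2 ->
    exec orc (While b c) s (t1 + t2).+1 s2
| exec_while_false b c s :
    ~~ beval s b -> exec orc (While b c) s 1 s
| exec_query qarr resarr s :
    exec orc (Query qarr resarr) s 1 (query_answer orc s qarr resarr).

(* n and W are the first two cells of natural array 0; real array 0 holds the
   probabilities and real array 1 the vectors a_i, in row-major order.  All
   other cells are unconstrained. *)
Definition input_state (R : realType) (n W : nat) (p : 'I_n -> R)
    (a : 'I_W -> 'I_n -> R) (s : state R) : Prop :=
  [/\ nmem s 0%N 0%N = n,
      nmem s 0%N 1%N = W,
      forall e : 'I_n, rmem s 0%N e = p e &
      forall (i : 'I_W) (e : 'I_n), rmem s 1%N (i * n + e)%N = a i e].

(* The answer overwrites natural array 0. *)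
Definition output_state (R : realType) (n : nat) (sigma : seq 'I_n)
    (s : state R) : Prop :=
  forall k, (k < size (seq_code sigma))%N ->
    nmem s 0%N k = nth 0%N (seq_code sigma) k.

Lemma exec_functional (R : realType) (n : nat)
    (orc : ('I_n -> R) -> seq 'I_n) c s t1 s1 t2 s2 :
  exec orc c s t1 s1 -> exec orc c s t2 s2 -> t1 = t2 /\ s1 = s2.
Proof.
move=> H; elim: H t2 s2 => {c s t1 s1}
  [s|arr idx x s|arr idx x s|c1 c2 s s1 s2 t1 t2 _ IH1 _ IH2
  |b c1 c2 s s1 t hb _ IH|b c1 c2 s s1 t hb _ IH
  |b c s s1 s2 t1 t2 hb _ IH1 _ IH2|b c s hb|q r s] t' s' H;
  inversion H; subst => //;
  repeat match goal with
  | IH : (forall _ _, exec _ ?c ?s _ _ -> _), H : exec _ ?c ?s _ _ |- _ =>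
      case: (IH _ _ H) => ? ?; subst; clear IH H
  | H1 : is_true (beval ?s ?b), H2 : is_true (~~ beval ?s ?b) |- _ =>
      by rewrite H1 in H2
  end; by [].
Qed.

Lemma adaptive_value_le_opt (R : realType) (X : finType) (W : nat)
    (a : 'I_W -> X -> R) (f : {set X} -> R) (p : X -> R) (F : seq X -> Prop)
    (T : dtree X) :
  xos_representation a f -> activation_probability p ->
  adaptive_strategy F T -> adaptive_value p f T <= adaptive_opt F p f.
Proof.
move=> [a0 fE] p01 FT; apply: ub_le_sup; last by exists T.
have fmono (A B : {set X}) : A \subset B -> f A <= f B.
  move=> AB; rewrite !fE; apply: (big_ind2 (fun x y : R => x <= y)) => //.
    by move=> x1 x2 y1 y2 h1 h2; rewrite ge_max !le_max h1 h2 /= orbT.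
  move=> i _; rewrite [leRHS](big_setID A) /= (finset.setIidPr AB) lerDl.
  exact: sumr_ge0.
exists (active_expectation p (fun=> f [set: X])) => _ [T' _ <-].
apply: ler_sum => A _; apply: ler_wpM2l; last exact/fmono/finset.subsetT.
apply: mulr_ge0; apply: prodr_ge0 => e _; case/andP: (p01 e) => // ? ?.
by rewrite subr_ge0.
Qed.

(* Main.v *)
(* Let [m e := f [set e]], and let the oracle answer two kinds of queries: the
   expected values [p e * a i e] of a single linear function, and, for each
   threshold [m k], the weights [p e * m e] restricted to the elements [e] with
   [m k <= m e].  An answer of the first kind is scored by its linear value, one
   of the second kind by the expectation of [m] at its first active element above
   the threshold; both scores are computable lower bounds of the nonadaptive
   value.  Let [B] be the best score and [K >= 3 B].

   Elements with [m e > K]: take as threshold the smallest such [m e].  If the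
   answer had activation mass at least 1/2 above it, its score would exceed
   [K / 3 >= B]; so the mass is below 1/2, the score is at least half the linear
   weight, and hence every feasible sequence has weight at most [2 B].  This
   bounds what an adaptive strategy gains from these elements.

   Elements with [m e <= K]: along the decision tree, the exponential moment of
   [\sum_e a i e / (2 K)] is at most [expR (B / K)], since each root-leaf sequence
   has linear weight at most [B]; a union bound over the [W] functions gives an
   expected maximum of at most [2 K ln W + 3 K]. *)

Require Import Defs.
From HB Require Import structures.
From mathcomp Require Import all_boot all_order all_algebra.
From mathcomp Require Import all_classical all_reals.
From mathcomp Require Import sequences exp.
From mathcomp Require Import zify ring lra.
Set Implicit Arguments.
Unset Strict Implicit.
Unset Printing Implicit Defensive.
Import Order.TTheory GRing.Theory Num.Theory.
Local Open Scope ring_scope.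

(** * Expectations over the random active set *)

Section Expectation.
Variables (R : realType) (X : finType) (p : X -> R).
Hypothesis p01 : activation_probability p.
Implicit Types (A : {set X}) (g h : {set X} -> R) (e : X).

Let p_ge0 e : 0 <= p e. Proof. by case/andP: (p01 e). Qed.
Let p_le1 e : p e <= 1. Proof. by case/andP: (p01 e). Qed.

Lemma active_probE A :
  active_prob p A = \prod_e (if e \in A then p e else 1 - p e).
Proof.
rewrite /active_prob [RHS](bigID (mem A)) /=.
rewrite [X in _ = X * _](eq_bigr p) => [|e ->//].
rewrite [X in _ = _ * X](eq_bigr (fun e => 1 - p e)) => [|e /negbTE ->//].
by congr (_ * _); apply: eq_bigl => e; rewrite inE.
Qed.

Lemma active_prob_ge0 A : 0 <= active_prob p A.
Proof.
by rewrite active_probE; apply: prodr_ge0 => e _; case: ifP => _; rewrite ?subr_ge0.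
Qed.

Lemma active_expectation_cst (c : R) : active_expectation p (fun=> c) = c.
Proof.
rewrite /active_expectation -mulr_suml.
under eq_bigr do rewrite active_probE.
(* Expanding [\prod_e (p e + (1 - p e))] over all subsets gives the total mass, and every factor is
   1. *)
have <- := bigA_distr 1 +%R p (fun e => 1 - p e).
by rewrite big1 ?mul1r// => e _ /=; rewrite addrCA subrr addr0.
Qed.

Lemma le_active_expectation g h :
  (forall A, g A <= h A) -> active_expectation p g <= active_expectation p h.
Proof. by move=> gh; apply: ler_sum => A _; rewrite ler_wpM2l ?active_prob_ge0. Qed.

Lemma active_expectationD g h :
  active_expectation p (fun A => g A + h A) =
  active_expectation p g + active_expectation p h.
Proof. by rewrite -big_split; apply: eq_bigr => A _; rewrite mulrDr. Qed.

Lemma active_expectationZ (c : R) g :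
  active_expectation p (fun A => c * g A) = c * active_expectation p g.
Proof. by rewrite mulr_sumr; apply: eq_bigr => A _; rewrite mulrCA. Qed.

Lemma active_expectation_sum (I : finType) (G : I -> {set X} -> R) :
  active_expectation p (fun A => \sum_i G i A) =
  \sum_i active_expectation p (G i).
Proof.
rewrite /active_expectation exchange_big; apply: eq_bigr => A _.
by rewrite mulr_sumr.
Qed.

(** Conditioning on the activity of [e]. All three expectations are folded onto the sets that avoid
    [e], where [rest] is the weight of the remaining coordinates. *)
Lemma active_expectation_split e g :
  active_expectation p g =
  p e * active_expectation p (fun A => g (e |: A)) +
  (1 - p e) * active_expectation p (fun A => g (A :\ e)).
Proof.
pose rest A := \prod_(x | x != e) (if x \in A then p x else 1 - p x).
have restU A : rest (e |: A) = rest A.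
  by apply: eq_bigr => x xe; rewrite !inE (negbTE xe).
have halves h : active_expectation p h =
    \sum_(A : {set X} | e \notin A)
      (p e * rest A * h (e |: A) + (1 - p e) * rest A * h A).
  rewrite /active_expectation (bigID (fun A : {set X} => e \in A)) /=.
  rewrite big_split /=; congr (_ + _).
    rewrite (reindex_onto (fun A => e |: A) (fun A => A :\ e)) /=; last first.
      by move=> A eA; rewrite finset.setD1K.
    apply: eq_big => [A|A _].
      rewrite finset.setU11 /=; apply/eqP/idP => [<-|eA].
        by rewrite !inE eqxx.
      by rewrite finset.setU1K.
    by rewrite active_probE (bigD1 e)//= finset.setU11 -/(rest _) restU.
  apply: eq_bigr => A eA.
  by rewrite active_probE (bigD1 e)//= (negbTE eA).
rewrite !halves !mulr_sumr -big_split; apply: eq_bigr => A eA /=.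
rewrite finset.setU1K // finset.setUA finset.setUid.
have -> : A :\ e = A by apply/finset.setP => x; rewrite !inE; case: eqP => // ->; rewrite (negbTE eA).
ring.
Qed.

Lemma active_expectation_if e g h :
  (forall A, g (e |: A) = g A) -> (forall A, h (A :\ e) = h A) ->
  active_expectation p (fun A => if e \in A then g A else h A) =
  p e * active_expectation p g + (1 - p e) * active_expectation p h.
Proof.
move=> gU hD; rewrite (active_expectation_split e); congr (_ * _ + _ * _).
  by apply: eq_bigr => A _; rewrite finset.setU11 gU.
by apply: eq_bigr => A _; rewrite !inE eqxx hD.
Qed.

Lemma active_expectation_mem e : active_expectation p (fun A => (e \in A)%:R) = p e.
Proof.
rewrite (active_expectation_split e).
under eq_fun do rewrite finset.setU11.
under [X in _ + _ * active_expectation _ X]eq_fun do rewrite !inE eqxx.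
by rewrite !active_expectation_cst mulr1 mulr0 addr0.
Qed.

Lemma active_expectation_sum_mem (w : X -> R) (S : {set X}) :
  active_expectation p (fun A => \sum_(e in A :&: S) w e) =
  \sum_(e in S) p e * w e.
Proof.
have -> : (fun A : {set X} => \sum_(e in A :&: S) w e) =
          (fun A => \sum_e (if e \in S then w e else 0) * (e \in A)%:R).
  apply/funext => A; rewrite big_mkcond; apply: eq_bigr => e _ /=.
  by rewrite inE; case: (e \in A); case: (e \in S); rewrite ?mulr1 ?mulr0 ?mul0r.
rewrite active_expectation_sum [RHS]big_mkcond; apply: eq_bigr => e _.
rewrite active_expectationZ active_expectation_mem.
by case: ifP; rewrite ?mul0r // mulrC.
Qed.

(** * Decision trees *)

Lemma branches_neq_nil (T : dtree X) : branches T != [::].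
Proof. by elim: T => //= x no IH yes _; case: (branches no) IH. Qed.

Lemma observed_setU1 (T : dtree X) e A :
  (forall s, s \in branches T -> e \notin s) ->
  observed T (e |: A) = observed T A.
Proof.
elim: T => //= x no IHn yes IHy H; rewrite !inE.
have Hs s : s \in branches no ++ branches yes -> (x != e) && (e \notin s).
  move=> /(map_f (cons x)) /H; rewrite inE negb_or => /andP[ex ->].
  by rewrite eq_sym ex.
(* The hypothesis speaks of branches only, so a branch through the root has to be exhibited before
   it says anything about [x]. *)
have xe : x != e.
  have [s sn] : exists s, s \in branches no ++ branches yes.
    have := branches_neq_nil no.
    by case: (branches no) => // s l _; exists s; rewrite mem_head.
  by case/andP: (Hs _ sn).
rewrite (negbTE xe) /= IHn ?IHy // => s sT.
  by have /Hs/andP[] : s \in branches no ++ branches yes by rewrite mem_cat sT orbT.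
by have /Hs/andP[] : s \in branches no ++ branches yes by rewrite mem_cat sT.
Qed.

Lemma observed_setD1 (T : dtree X) e A :
  (forall s, s \in branches T -> e \notin s) ->
  observed T (A :\ e) = observed T A.
Proof.
move=> H; have [eA|eA] := boolP (e \in A).
  by rewrite -[in RHS](finset.setD1K eA) observed_setU1.
by congr observed; apply/finset.setP => x; rewrite !inE; case: eqP => // ->; rewrite (negbTE eA).
Qed.

Lemma branches_Probe e (no yes : dtree X) s :
  s \in branches no ++ branches yes -> e :: s \in branches (Probe e no yes).
Proof. exact: map_f. Qed.

(** No element repeats on a path, so neither subtree probes [e] and what they observe is independent
    of its activity. *)
Lemma active_expectation_Probe e (no yes : dtree X) g :
  (forall s, s \in branches (Probe e no yes) -> uniq s) ->
  active_expectation p (fun A => g (observed (Probe e no yes) A)) =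
  p e * active_expectation p (fun A => g (e |: observed yes A)) +
  (1 - p e) * active_expectation p (fun A => g (observed no A)).
Proof.
move=> U.
have notin s : s \in branches no ++ branches yes -> e \notin s.
  by move/(branches_Probe e)/U => /= /andP[].
rewrite /= -active_expectation_if; first by under eq_fun do rewrite fun_if.
- move=> A; rewrite observed_setU1 // => s sT.
  by apply: notin; rewrite mem_cat sT ?orbT.
- move=> A; rewrite observed_setD1 // => s sT.
  by apply: notin; rewrite mem_cat sT ?orbT.
Qed.

(** Budget accounting for the two inductions below: a probe of [e] uses up [w e] of the budget [M],
    whichever arc is followed. *)
Lemma branch_sums_Probe (M : R) (w : X -> R) e no yes :
  (forall s, s \in branches (Probe e no yes) ->
     uniq s /\ \sum_(x <- s) w x <= M) ->
  (forall s, s \in branches no -> uniq s /\ \sum_(x <- s) w x <= M - w e) /\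
  (forall s, s \in branches yes -> uniq s /\ \sum_(x <- s) w x <= M - w e).
Proof.
move=> H; have {}H s : s \in branches no ++ branches yes ->
    uniq s /\ \sum_(x <- s) w x <= M - w e.
  move/(branches_Probe e)/H => /= [/andP[_ ->]].
  by rewrite big_cons lerBrDl.
by split=> s sT; apply: H; rewrite mem_cat sT ?orbT.
Qed.

(** Adaptivity does not help for linear functions: a probe of [e] gains at most [p e * w e] in
    expectation, exactly what it takes from the budget on both arcs. *)
Lemma expectation_sum_observed_le (w : X -> R) (M : R) (T : dtree X) :
  (forall e, 0 <= w e) ->
  (forall s, s \in branches T -> uniq s /\ \sum_(e <- s) p e * w e <= M) ->
  active_expectation p (fun A => \sum_(e in observed T A) w e) <= M.
Proof.
move=> w0; elim: T M => [|e no IHn yes IHy] M H.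
  have [_] := H [::] (mem_head _ _); rewrite big_nil => M0.
  rewrite (le_trans _ M0)//; under eq_fun do rewrite big_set0.
  by rewrite active_expectation_cst.
rewrite (active_expectation_Probe (fun S => \sum_(e in S) w e)); last first.
  by move=> s /H[].
have [/IHn Hn /IHy Hy] := branch_sums_Probe H.
have {}Hy : active_expectation p
    (fun A => \sum_(x in e |: observed yes A) w x) <= w e + (M - p e * w e).
  apply: le_trans (_ : active_expectation p
    (fun A => w e + \sum_(x in observed yes A) w x) <= _).
    apply: le_active_expectation => A.
    have [eA|eA] := boolP (e \in observed yes A); last by rewrite big_setU1.
    by rewrite (finset.setUidPr _) ?finset.sub1set ?lerDr.
  by rewrite active_expectationD active_expectation_cst lerD2l.
apply: le_trans (lerD (ler_wpM2l (p_ge0 e) Hy) (ler_wpM2l _ Hn)) _.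
  by rewrite subr_ge0.
by lra.
Qed.

(** Supermartingale argument: a probe of [e] contributes a factor of at most [1 + x] with
    [x := p e * (expR (w e) - 1)], and [1 + x <= expR x] is paid for by the drop of the budget from
    [M] to [M - x]. *)
Lemma expectation_expR_observed_le (w : X -> R) (M : R) (T : dtree X) :
  (forall e, 0 <= w e) ->
  (forall s, s \in branches T ->
     uniq s /\ \sum_(e <- s) p e * (expR (w e) - 1) <= M) ->
  active_expectation p (fun A => expR (\sum_(e in observed T A) w e))
    <= expR M.
Proof.
move=> w0; elim: T M => [|e no IHn yes IHy] M H.
  have [_] := H [::] (mem_head _ _); rewrite big_nil => M0.
  under eq_fun do rewrite big_set0.
  by rewrite active_expectation_cst ler_expR.
rewrite (active_expectation_Probe (fun S => expR (\sum_(e in S) w e))); last first.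
  by move=> s /H[].
have [/IHn Hn /IHy Hy] := branch_sums_Probe H.
set x := p e * (expR (w e) - 1) in Hn Hy.
have {}Hy : active_expectation p
    (fun A => expR (\sum_(x in e |: observed yes A) w x)) <=
    expR (w e) * expR (M - x).
  apply: le_trans (_ : active_expectation p
    (fun A => expR (w e) * expR (\sum_(x in observed yes A) w x)) <= _).
    apply: le_active_expectation => A; rewrite -expRD ler_expR.
    have [eA|eA] := boolP (e \in observed yes A); last by rewrite big_setU1.
    by rewrite (finset.setUidPr _) ?finset.sub1set ?lerDr.
  by rewrite active_expectationZ ler_wpM2l ?expR_ge0.
apply: le_trans (lerD (ler_wpM2l (p_ge0 e) Hy) (ler_wpM2l _ Hn)) _.
  by rewrite subr_ge0.
rewrite (_ : _ + _ = (1 + x) * expR (M - x)); last by rewrite /x; ring.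
apply: le_trans (_ : expR x * expR (M - x) <= _).
  by rewrite ler_wpM2r ?expR_ge0 ?expR_ge1Dx.
by rewrite -expRD addrC subrK.
Qed.

End Expectation.

(** * Scores of probing sequences *)

(* When [q e = p e * v e] and [z = p] on a set of elements, and both vanish
   outside of it, [score q z s] is the expected value of [v] at the first
   active element of [s] that belongs to this set. *)
Fixpoint score (R : realType) (X : Type) (q z : X -> R) (s : seq X) : R :=
  if s is e :: s' then q e + (1 - z e) * score q z s' else 0.

Section Score.
Variables (R : realType) (X : eqType) (q z : X -> R).
Hypotheses (q0 : forall e, 0 <= q e) (z01 : forall e, 0 <= z e <= 1).

Let z0 e : 0 <= z e. Proof. by case/andP: (z01 e). Qed.
Let z1 e : 0 <= 1 - z e. Proof. by rewrite subr_ge0; case/andP: (z01 e). Qed.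

(** Each [q e] is damped by the product of the earlier factors [1 - z], which is at least one minus
    the sum of all [z] (union bound). *)
Lemma score_ge_sum (s : seq X) :
  (1 - \sum_(e <- s) z e) * \sum_(e <- s) q e <= score q z s.
Proof.
elim: s => [|e s IH] /=; first by rewrite !big_nil mulr0.
rewrite !big_cons; have Q0 : 0 <= \sum_(e <- s) q e by exact: sumr_ge0.
have Z0 : 0 <= \sum_(e <- s) z e by exact: sumr_ge0.
have := ler_wpM2l (z1 e) IH; move: (score _ _ _) (z0 e) (q0 e) Q0 Z0.
move: (\sum_(e <- s) q e) (\sum_(e <- s) z e) (q e) (z e).
move=> Q Z a b S b0 a0 Q0 Z0.
have := mulr_ge0 (mulr_ge0 b0 Z0) Q0; have := mulr_ge0 b0 a0.
by have := mulr_ge0 Z0 a0; nra.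
Qed.

(** [1 - P] is the probability of meeting an active element, each worth at least [theta]. Since
    [(1 - z) * (1 + z) <= 1], mass 1/2 forces [P <= 2 / 3]. *)
Lemma score_ge_threshold (theta : R) (s : seq X) :
  0 <= theta -> (forall e, theta * z e <= q e) ->
  2^-1 <= \sum_(e <- s) z e -> theta / 3 <= score q z s.
Proof.
move=> t0 tq.
pose P := \prod_(e <- s) (1 - z e).
have scoreP : theta * (1 - P) <= score q z s.
  rewrite /P; elim: s {P} => [|e s IH] /=; first by rewrite big_nil subrr mulr0.
  rewrite big_cons; have := ler_wpM2l (z1 e) IH; have := tq e.
  move: (score _ _ _) (\prod_(_ <- _) _) (q e) (z e) => S P a b; lra.
have P0 : 0 <= P by exact: prodr_ge0.
have PZ : P * (1 + \sum_(e <- s) z e) <= 1.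
  rewrite /P; elim: s {P P0 scoreP} => [|e s IH] /=.
    by rewrite !big_nil addr0 mulr1.
  rewrite !big_cons; apply: le_trans IH.
  have P0 : 0 <= \prod_(e <- s) (1 - z e) by exact: prodr_ge0.
  have Z0 : 0 <= \sum_(e <- s) z e by exact: sumr_ge0.
  rewrite mulrAC mulrC ler_wpM2l //.
  have := z0 e; nra.
move=> Z2; have : P <= 2 / 3 by nra.
by move: scoreP; nra.
Qed.

End Score.

(** From [1 - x <= expR (- x)] one gets [expR x - 1 <= x / (1 - x)], and the denominator is at least
    1/2. *)
Lemma expR_sub1_le (R : realType) (x : R) : 0 <= x <= 2^-1 -> expR x - 1 <= 2 * x.
Proof.
move=> /andP[x0 x2]; have := expR_ge1Dx (- x); rewrite expRN.
have := expR_gt0 x; set y := expR x => y0 H.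
have : (1 - x) * y <= 1.
  by have := ler_wpM2r (ltW y0) H; rewrite mulVf ?gt_eqF.
by nra.
Qed.

(** * XOS functions, and scores as lower bounds of the nonadaptive value *)

Section XOS.
Variables (R : realType) (X : finType) (W : nat).
Variables (a : 'I_W -> X -> R) (f : {set X} -> R).
Hypothesis xos : xos_representation a f.

Lemma xos_ge (S : {set X}) i : \sum_(e in S) a i e <= f S.
Proof. by case: xos => _ ->; exact: le_bigmax. Qed.

Lemma xos_ge0 (S : {set X}) : 0 <= f S.
Proof. by case: xos => _ ->; apply: bigmax_ge_id. Qed.

Lemma xos_le (S : {set X}) (c : R) :
  0 <= c -> (forall i, \sum_(e in S) a i e <= c) -> f S <= c.
Proof. by case: xos => _ -> c0 H; apply: bigmax_le. Qed.

Lemma xos_ge_single e i : a i e <= f [set e].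
Proof. by have := xos_ge [set e] i; rewrite big_set1. Qed.

Lemma xos_mono (S S' : {set X}) : S \subset S' -> f S <= f S'.
Proof.
move=> SS'; apply: xos_le => [|i]; first exact: xos_ge0.
apply: le_trans (xos_ge S' i).
rewrite [leRHS](big_setID S) /= (finset.setIidPr SS') lerDl.
by apply: sumr_ge0 => e _; case: xos.
Qed.

Variable (p : X -> R).
Hypothesis p01 : activation_probability p.

Let p_ge0 e : 0 <= p e. Proof. by case/andP: (p01 e). Qed.

Lemma score_sum_le_nonadaptive_value i (s : seq X) :
  uniq s ->
  score (fun e => p e * a i e) (fun=> 0) s <= nonadaptive_value p f s.
Proof.
move=> Us; have -> : score (fun e => p e * a i e) (fun=> 0) s =
    \sum_(e in [set e in s]) p e * a i e.
  under eq_bigl do rewrite inE.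
  rewrite -big_uniq //; elim: s {Us} => [|e s IH] /=; first by rewrite big_nil.
  by rewrite big_cons IH subr0 mul1r.
rewrite -active_expectation_sum_mem //; apply: le_active_expectation => // A.
exact: xos_ge.
Qed.

Lemma score_first_le_nonadaptive_value (D : pred X) (s : seq X) :
  uniq s ->
  score (fun e => if D e then p e * f [set e] else 0)
        (fun e => if D e then p e else 0) s <= nonadaptive_value p f s.
Proof.
(* The value collected when only the first active element of [D] counts; by monotonicity it is at
   most [f] of all active probed elements. *)
pose first := fix first (l : seq X) (A : {set X}) {struct l} : R :=
  if l is e :: l' then if e \in A then if D e then f [set e] else first l' A
                       else first l' A else 0.
have firstU e l A : e \notin l -> first l (e |: A) = first l A.
  elim: l => //= x l IH; rewrite inE negb_or => /andP[ex /IH ->].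
  by rewrite !inE eq_sym (negbTE ex).
have firstD e l A : e \notin l -> first l (A :\ e) = first l A.
  move=> el; have [eA|eA] := boolP (e \in A).
    by rewrite -[in RHS](finset.setD1K eA) firstU.
  congr first; apply/finset.setP => x; rewrite !inE.
  by case: eqP => // ->; rewrite (negbTE eA).
move=> Us; apply: le_trans (_ : active_expectation p (first s) <= _).
  elim: s Us => [|e s IH] /=; first by rewrite active_expectation_cst.
  move=> /andP[es /IH {}IH]; rewrite active_expectation_if; first last.
  - by move=> A; exact: firstD.
  - by move=> A; case: ifP => // _; exact: firstU.
  case: ifP => _.
    rewrite active_expectation_cst // lerD2l ler_wpM2l ?subr_ge0 //.
    by case/andP: (p01 e).
  by rewrite add0r subr0 mul1r -mulrDl addrC subrK mul1r.
apply: le_active_expectation => // A; elim: s Us => [|e s IH] /=.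
  by rewrite xos_ge0.
move=> /andP[es /IH {}IH].
have le_cons : f (A :&: [set e in s]) <= f (A :&: [set x in e :: s]).
  apply: xos_mono; apply: finset.setIS; apply/fintype.subsetP => x.
  by rewrite !inE orbC => ->.
case: ifP => eA; last exact: le_trans le_cons.
case: ifP => _; last exact: le_trans le_cons.
by apply: xos_mono; rewrite finset.sub1set !inE eA eqxx.
Qed.

(** * The adaptive optimum against the best score [B] *)

Variables (F : seq X -> Prop) (orc : (X -> R) -> seq X) (B : R).
Hypotheses (Fprobe : probing_constraint F) (orcP : linear_oracle F orc).
Let qsum i e := p e * a i e.
Let qtop k e := if f [set k] <= f [set e] then p e * f [set e] else 0.
Let ztop k e := if f [set k] <= f [set e] then p e else 0.
Hypothesis B_ge_sum : forall i, score (qsum i) (fun=> 0) (orc (qsum i)) <= B.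
Hypothesis B_ge_top : forall k, score (qtop k) (ztop k) (orc (qtop k)) <= B.

Let a0 i e : 0 <= a i e. Proof. by case: xos. Qed.

Lemma feasible_sum_le i (s : seq X) : F s -> \sum_(e <- s) p e * a i e <= B.
Proof.
have q0 e : 0 <= qsum i e by rewrite mulr_ge0.
move=> /(orcP q0).2 /le_trans; apply; apply: le_trans (B_ge_sum i).
elim: (orc _) => [|e l IH] /=; first by rewrite big_nil.
by rewrite big_cons subr0 mul1r lerD2l.
Qed.

Lemma feasible_large_sum_le (K : R) (s : seq X) :
  0 <= B -> 3 * B <= K -> F s ->
  \sum_(e <- s) p e * (if K < f [set e] then f [set e] else 0) <= 2 * B.
Proof.
move=> B0 BK Fs.
have [k0 K_k0|small] := pickP (fun e => K < f [set e]); last first.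
  rewrite big1 ?mulr_ge0 // => e _.
  by have -> := small e; rewrite mulr0.
(* With the smallest large value as threshold, being above [K] coincides with being above [f
   [set k]], so the large elements form the support of one of the queries. *)
case: (@arg_minP _ _ _ k0 (fun e => K < f [set e]) (fun e => f [set e]) K_k0) => k K_k kmin.
have largeE e : (K < f [set e]) = (f [set k] <= f [set e]).
  by apply/idP/idP => [/kmin|]; [|exact: lt_le_trans].
have q0 e : 0 <= qtop k e.
  by rewrite /qtop; case: ifP => // _; rewrite mulr_ge0 ?xos_ge0.
have z01 e : 0 <= ztop k e <= 1.
  by rewrite /ztop; case: ifP => // _; rewrite lexx ler01.
set l := orc (qtop k).
have Zl : \sum_(e <- l) ztop k e < 2^-1.
  rewrite ltNge; apply/negP => Z2.
  have tq e : f [set k] * ztop k e <= qtop k e.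
    rewrite /ztop /qtop; case: ifP => [kle|_]; last by rewrite mulr0.
    by rewrite mulrC ler_wpM2l.
  have := score_ge_threshold z01 (xos_ge0 _) tq Z2.
  have := B_ge_top k; rewrite -/l; lra.
have Ql : \sum_(e <- l) qtop k e <= 2 * B.
  have Q0 : 0 <= \sum_(e <- l) qtop k e by exact: sumr_ge0.
  have := score_ge_sum q0 z01 l; have := B_ge_top k; rewrite -/l.
  by nra.
apply: le_trans Ql; apply: le_trans ((orcP q0).2 _ Fs).
apply: ler_sum => e _; rewrite /qtop largeE.
by case: ifP => // _; rewrite mulr0.
Qed.

Lemma adaptive_value_le (K : R) (T : dtree X) :
  (0 < W)%N -> 0 <= B -> 0 < K -> 3 * B <= K -> adaptive_strategy F T ->
  adaptive_value p f T <= 2 * B + 2 * K * ln W%:R + 3 * K.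
Proof.
move=> W0 B0 K0 BK FT.
(* Splitting at [K]. Dividing by [2 * K] puts the small weights in the range of [expR_sub1_le]. *)
pose big e := if K < f [set e] then f [set e] else 0.
pose small i e := if K < f [set e] then 0 else a i e / (2 * K).
have big0 e : 0 <= big e by rewrite /big; case: ifP => // _; exact: xos_ge0.
have K2 : 0 < 2 * K by rewrite mulr_gt0.
have small0 i e : 0 <= small i e.
  by rewrite /small; case: ifP => // _; rewrite divr_ge0 // ltW.
have small1 i e : small i e <= 2^-1.
  rewrite /small; case: ifP => [_|/negbT]; first by rewrite invr_ge0.
  rewrite -leNgt => mK; rewrite ler_pdivrMr //.
  by have := xos_ge_single e i; lra.
have W0R : 0 < W%:R :> R by rewrite ltr0n.
have fle (S : {set X}) : f S <= \sum_(e in S) big e +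
    (2 * K * ln W%:R +
     2 * K * \sum_i W%:R^-1 * expR (\sum_(e in S) small i e)).
  have lnW : 0 <= ln W%:R :> R by apply: ln_ge0; rewrite ler1n.
  have sum0 : 0 <= \sum_(i < W) W%:R^-1 * expR (\sum_(e in S) small i e).
    by apply: sumr_ge0 => i _; rewrite mulr_ge0 ?expR_ge0 ?invr_ge0 ?ltW.
  apply: xos_le => [|i].
    by rewrite !addr_ge0 ?sumr_ge0 ?mulr_ge0 // ltW.
  apply: le_trans (_ : \sum_(e in S) big e + 2 * K * \sum_(e in S) small i e <= _).
    rewrite mulr_sumr -big_split; apply: ler_sum => e _ /=.
    rewrite /big /small; case: ifP => _.
      by rewrite mulr0 addr0 xos_ge_single.
    by rewrite add0r mulrCA mulfV ?mulr1 ?gt_eqF.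
  rewrite lerD2l -mulrDr ler_pM2l //.
  set y := \sum_(e in S) small i e.
  (* The tangent bound [1 + (y - ln W) <= expR (y - ln W) = expR y / W] turns the maximum into a sum
     of exponentials pointwise, before any expectation is taken. *)
  apply: le_trans (_ : ln W%:R + W%:R^-1 * expR y <= _); last first.
    rewrite lerD2l (bigD1 i) //= lerDl; apply: sumr_ge0 => j _.
    by rewrite mulr_ge0 ?expR_ge0 ?invr_ge0 ?ltW.
  have := expR_ge1Dx (y - ln W%:R); rewrite expRD expRN lnK ?posrE // mulrC.
  lra.
apply: le_trans (le_active_expectation p01 (fun A => fle (observed T A))) _.
rewrite !(active_expectationD, active_expectationZ, active_expectation_sum) //.
rewrite active_expectation_cst // -addrA lerD //.
  apply: expectation_sum_observed_le => // s /FT [Us Fs]; split => //.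
  exact: feasible_large_sum_le.
rewrite lerD2l (_ : 3 * K = 2 * K * (3 / 2)); last by field.
rewrite ler_pM2l //.
apply: le_trans (_ : \sum_(i < W) W%:R^-1 * (3 / 2) <= _); last first.
  rewrite sumr_const card_ord -[leLHS]mulr_natl mulrA mulfV ?mul1r //.
  by rewrite gt_eqF.
apply: ler_sum => i _; rewrite active_expectationZ ler_pM2l ?invr_gt0 //.
(* The budget is [B / K <= 1 / 3], and [expR (- 3^-1) >= 2 / 3] gives [expR 3^-1 <= 3 / 2]. *)
apply: (@le_trans _ _ (expR 3^-1)); last first.
  have := expR_ge1Dx (- 3^-1 : R); rewrite expRN.
  have := expR_gt0 (3^-1 : R); set y := expR _ => y0 H.
  by have := ler_wpM2r (ltW y0) H; rewrite mulVf ?gt_eqF //; lra.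
apply: expectation_expR_observed_le => // s /FT [Us Fs]; split => //.
apply: le_trans (_ : \sum_(e <- s) K^-1 * (p e * a i e) <= _).
  apply: ler_sum => e _; rewrite mulrCA ler_wpM2l //.
  apply: le_trans (expR_sub1_le _) _; first by rewrite small0 small1.
  rewrite /small; case: ifP => _; first by rewrite mulr0 mulr_ge0 // invr_ge0 ltW.
  rewrite (_ : 2 * _ = K^-1 * a i e) //; field.
  by rewrite gt_eqF.
rewrite -mulr_sumr mulrC ler_pdivrMr //.
by have := feasible_sum_le i Fs; lra.
Qed.

Lemma adaptive_opt_le :
  (0 < W)%N -> 0 <= B -> adaptive_opt F p f <= 17 * B * log2_width R W.
Proof.
move=> W0 B0; have Fnil : F [::].
  by case: Fprobe => _; apply; [exact: prefix0s|exact: (orcP (fun=> lexx 0)).1].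
apply: ge_sup.
  exists (adaptive_value p f Leaf); exists Leaf => // s.
  by rewrite inE => /eqP ->.
move=> _ [T FT <-].
have ln2_gt0 : 0 < ln 2 :> R by apply: ln_gt0; lra.
have ln2_le1 : ln 2 <= 1 :> R.
  by rewrite -[2]/(1 + 1); apply: le_ln1Dx; lra.
have lnW : ln W%:R <= log2_width R W.
  rewrite /log2_width le_max; apply/orP; right.
  rewrite ler_pdivlMr // ler_piMr //.
  by apply: ln_ge0; rewrite ler1n.
have L1 : 1 <= log2_width R W by rewrite /log2_width le_max lexx.
have lnW0 : 0 <= ln W%:R :> R by apply: ln_ge0; rewrite ler1n.
(* [K] must be positive while [B] may vanish, hence the slack [d], which is later sent to 0. With
   [K = 3 * B + d] the coefficient of [B] is 2 + 6 + 9 = 17, using that [log2_width] is at least 1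
   and at least [ln W]. *)
have le_d d : 0 < d -> adaptive_value p f T <=
    17 * B * log2_width R W + d * (2 * ln W%:R + 3).
  move=> d0; have K0 : 0 < 3 * B + d by lra.
  apply: le_trans (adaptive_value_le W0 B0 K0 _ FT) _; first by lra.
  nra.
apply/ler_addgt0Pr => d d0.
have c0 : 0 < 2 * ln W%:R + 3 :> R by lra.
by have := le_d (d / (2 * ln W%:R + 3)); rewrite divfK ?gt_eqF //; apply; rewrite divr_gt0.
Qed.

End XOS.

(** * Total correctness of programs *)

Fixpoint nwrites (c : cmd) : seq nat :=
  match c with
  | NSet arr _ _ => [:: arr]
  | Seq c1 c2 | If _ c1 c2 => nwrites c1 ++ nwrites c2
  | While _ c1 => nwrites c1
  | Query _ resarr => [:: resarr]
  | _ => [::]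
  end.

Fixpoint rwrites (c : cmd) : seq nat :=
  match c with
  | RSet arr _ _ => [:: arr]
  | Seq c1 c2 | If _ c1 c2 => rwrites c1 ++ rwrites c2
  | While _ c1 => rwrites c1
  | _ => [::]
  end.

(** Frame condition, read off the program text; it lets loop invariants mention only the arrays that
    the loop modifies. *)
Definition same_outside (R : Type) (c : cmd) (s s' : state R) : Prop :=
  (forall arr, arr \notin nwrites c -> nmem s' arr = nmem s arr) /\
  (forall arr, arr \notin rwrites c -> rmem s' arr = rmem s arr).

Definition nset (R : Type) (s : state R) (arr idx v : nat) : state R :=
  State (upd (nmem s) arr idx v) (rmem s).

Definition rset (R : Type) (s : state R) (arr idx : nat) (v : R) : state R :=
  State (nmem s) (upd (rmem s) arr idx v).

Definition ncell (arr : nat) : nexp := NGet arr (NConst 0).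
Definition rcell (arr : nat) : rexp := RGet arr (NConst 0).

Definition For (v b : nat) (c : cmd) : cmd :=
  Seq (NSet v (NConst 0) (NConst 0))
    (While (NLe (NAdd (ncell v) (NConst 1)) (ncell b))
       (Seq c (NSet v (NConst 0) (NAdd (ncell v) (NConst 1))))).

Section Triples.
Variables (R : realType) (n : nat) (orc : ('I_n -> R) -> seq 'I_n).
Implicit Types (s : state R) (Q : state R -> Prop) (c : cmd).

Definition halts_with (T : nat) c s Q : Prop :=
  exists t s', [/\ exec orc c s t s', (t <= T)%N & Q s'].

Lemma upd_other (V : Type) (m : nat -> nat -> V) arr idx v arr' :
  arr' != arr -> upd m arr idx v arr' = m arr'.
Proof. by move=> /negbTE h; apply/funext => i; rewrite /upd h. Qed.

Lemma exec_same_outside c s t s' : exec orc c s t s' -> same_outside c s s'.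
Proof.
elim=> {c s t s'} /= [s|arr idx x s|arr idx x s|c1 c2 s s1 s2 t1 t2 _ [N1 R1] _ [N2 R2]
  |b c1 c2 s s1 t hb _ [N1 R1]|b c1 c2 s s1 t hb _ [N1 R1]
  |b c s s1 s2 t1 t2 hb _ [N1 R1] _ [N2 R2]|b c s hb|q r s].
all: split=> arr' /=; rewrite ?mem_cat ?inE ?negb_or; try by [].
- exact: upd_other.
- exact: upd_other.
- by case/andP=> h1 h2; rewrite N2 ?N1.
- by case/andP=> h1 h2; rewrite R2 ?R1.
- by case/andP=> h1 h2; rewrite N1.
- by case/andP=> h1 h2; rewrite R1.
- by case/andP=> h1 h2; rewrite N1.
- by case/andP=> h1 h2; rewrite R1.
- by move=> h; rewrite N2 ?N1.
- by move=> h; rewrite R2 ?R1.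
- by move=> /negbTE h; apply/funext => i; rewrite h.
Qed.

Lemma halts_with_same_outside T c s Q :
  halts_with T c s (fun s' => same_outside c s s' -> Q s') ->
  halts_with T c s Q.
Proof.
by case=> t [s' [E tT H]]; exists t, s'; split=> //; exact/H/(exec_same_outside E).
Qed.

Lemma halts_with_weaken T T' c s Q Q' :
  halts_with T c s Q -> (T <= T')%N -> (forall s', Q s' -> Q' s') ->
  halts_with T' c s Q'.
Proof.
case=> t [s' [E tT H]] TT' QQ'; exists t, s'; split; [exact: E|exact: leq_trans TT'|exact: QQ'].
Qed.

Lemma halts_with_skip s Q : Q s -> halts_with 1 Skip s Q.
Proof. by move=> H; exists 1%N, s; split=> //; constructor. Qed.

Lemma halts_with_nset arr idx x s Q :
  Q (nset s arr (neval s idx) (neval s x)) ->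
  halts_with 1 (NSet arr idx x) s Q.
Proof. by move=> H; exists 1%N; eexists; split; [constructor| |exact: H]. Qed.

Lemma halts_with_rset arr idx x s Q :
  Q (rset s arr (neval s idx) (reval s x)) ->
  halts_with 1 (RSet arr idx x) s Q.
Proof. by move=> H; exists 1%N; eexists; split; [constructor| |exact: H]. Qed.

Lemma halts_with_query q r s Q :
  Q (query_answer orc s q r) -> halts_with 1 (Query q r) s Q.
Proof. by move=> H; exists 1%N; eexists; split; [constructor| |exact: H]. Qed.

Lemma halts_with_seq T1 T2 c1 c2 s Q :
  halts_with T1 c1 s (fun s1 => halts_with T2 c2 s1 Q) ->
  halts_with (T1 + T2) (Seq c1 c2) s Q.
Proof.
case=> t1 [s1 [E1 l1 [t2 [s2 [E2 l2 H]]]]].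
by exists (t1 + t2)%N, s2; split=> //; [exact: exec_seq E1 E2|exact: leq_add].
Qed.

Lemma halts_with_if T b c1 c2 s Q :
  (beval s b -> halts_with T c1 s Q) -> (~~ beval s b -> halts_with T c2 s Q) ->
  halts_with T.+1 (If b c1 c2) s Q.
Proof.
have [hb|hb] := boolP (beval s b).
  move=> /(_ isT) [t [s' [E l H]]] _; exists t.+1, s'; split=> //.
  exact: exec_if_true.
move=> _ /(_ isT) [t [s' [E l H]]]; exists t.+1, s'; split=> //.
exact: exec_if_false.
Qed.

(** The body leaves counter and bound alone, so there are exactly [N] rounds. A round costs the
    body, the increment and a test; the initialisation and the failing test give the additive 2. *)
Lemma halts_with_for (I : nat -> state R -> Prop) N T v b c s Q :
  nmem s b 0%N = N -> v \notin nwrites c -> b \notin nwrites c -> b != v ->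
  (forall j s' x, I j s' -> I j (nset s' v 0 x)) ->
  I 0%N s ->
  (forall j s', (j < N)%N -> nmem s' v 0%N = j ->
     same_outside (For v b c) s s' -> I j s' -> halts_with T c s' (I j.+1)) ->
  (forall s', I N s' -> same_outside (For v b c) s s' -> Q s') ->
  halts_with (2 + N * (T + 2)) (For v b c) s Q.
Proof.
move=> sb vc bc bv Iv I0 step QI.
have bFor : b \notin nwrites (For v b c).
  by rewrite /= inE mem_cat inE (negbTE bc) (negbTE bv).
pose next := NSet v (NConst 0) (NAdd (ncell v) (NConst 1)).
pose loop := While (NLe (NAdd (ncell v) (NConst 1)) (ncell b)) (Seq c next).
(* Induction on the number [k] of remaining rounds; the counter is then [N - k]. *)
have loopP k s1 : (k <= N)%N -> I (N - k)%N s1 -> nmem s1 v 0%N = (N - k)%N ->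
    same_outside (For v b c) s s1 ->
    halts_with (k * (T + 2) + 1) loop s1 (fun s' => I N s').
  elim: k s1 => [|k IH] s1 kN Is1 s1v out.
    exists 1%N, s1; split=> //; last by rewrite subn0 in Is1.
    apply: exec_while_false => /=; rewrite s1v.
    have -> : nmem s1 b 0%N = N.
      by rewrite (out.1 b bFor) sb.
    by lia.
  have s1b : nmem s1 b 0%N = N.
    by rewrite (out.1 b bFor) sb.
  have jN : (N - k.+1 < N)%N by lia.
  case: (step _ _ jN s1v out Is1) => t2 [s2 [E2 l2 I2]].
  have out2 := exec_same_outside E2.
  pose s3 := nset s2 v 0 (N - k)%N.
  have E3 : exec orc (Seq c next) s1 (t2 + 1) s3.
    apply: exec_seq E2 _.
    have -> : s3 = nset s2 v (neval s2 (NConst 0)) (neval s2 (NAdd (ncell v) (NConst 1))).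
      by rewrite /= (out2.1 v vc) s1v /s3; congr nset; lia.
    by constructor.
  have out3 := exec_same_outside E3.
  case: (IH s3); [by lia| | | |].
  - by rewrite /s3; apply: Iv; move: I2; congr I; lia.
  - by rewrite /s3 /= /upd !eqxx.
  - split=> arr h.
      rewrite (out3.1 arr) ?(out.1 arr) //.
      by move: h; rewrite /= inE negb_or => /andP[].
    by rewrite (out3.2 arr) ?(out.2 arr).
  - move=> t4 [s4 [E4 l4 I4]]; exists (t2 + 1 + t4).+1%N, s4; split=> //.
      apply: exec_while_true E3 E4; rewrite /= s1v s1b; lia.
    by lia.
pose s0 := nset s v 0 0.
case: (loopP N s0); rewrite ?subnn //.
- exact: Iv.
- by rewrite /s0 /= /upd !eqxx.
- split=> arr h //=; apply: upd_other.
  by move: h; rewrite /= inE negb_or => /andP[].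
- move=> t [s' [E l H]].
  have E' : exec orc (For v b c) s (1 + t) s' by apply: exec_seq E; constructor.
  exists (1 + t)%N, s'; split=> //; first by lia.
  exact: QI (exec_same_outside E').
Qed.

End Triples.

(** * The program *)

(* Arrays of naturals.  [OUT] is array 0: it initially holds n and W, and then
   the best sequence found so far. *)
Local Notation OUT := 0%N (only parsing).
Local Notation RES := 1%N (only parsing).
Local Notation SIZE := 2%N (only parsing).
Local Notation WIDTH := 3%N (only parsing).
Local Notation OUTER := 4%N (only parsing).
Local Notation ELT := 5%N (only parsing).
Local Notation POS := 6%N (only parsing).
Local Notation BASE := 7%N (only parsing).

(* Arrays of reals.  [TOP] receives the values [f [set e]]; [VAL] and [SURV]
   accumulate the score of the oracle's answer to the query [QRY], with the
   damping factors [DAMP] as second argument of [score]. *)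
Local Notation PROB := 0%N (only parsing).
Local Notation VEC := 1%N (only parsing).
Local Notation TOP := 2%N (only parsing).
Local Notation QRY := 3%N (only parsing).
Local Notation DAMP := 4%N (only parsing).
Local Notation BEST := 5%N (only parsing).
Local Notation VAL := 6%N (only parsing).
Local Notation SURV := 7%N (only parsing).

Local Notation "c1 ;; c2" := (Seq c1 c2) (at level 90, right associativity).

(** The offset 1 skips the length stored in front of the answer. *)
Definition answer_at_pos : nexp := NGet RES (NAdd (ncell POS) (NConst 1)).

(** [SURV] is the product of the factors [1 - z e] read so far, so the score can be evaluated front
    to back. *)
Definition scan_answer : cmd :=
  RSet VAL (NConst 0)
    (RAdd (rcell VAL) (RMul (rcell SURV) (RGet QRY answer_at_pos))) ;;
  RSet SURV (NConst 0)
    (RMul (rcell SURV) (RSub (RConst 1) (RGet DAMP answer_at_pos))).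

Definition store_answer : cmd :=
  RSet BEST (NConst 0) (rcell VAL) ;;
  NSet OUT (NConst 0) (ncell RES) ;;
  For POS RES (NSet OUT (NAdd (ncell POS) (NConst 1)) answer_at_pos).

Definition try_candidate : cmd :=
  Query QRY RES ;;
  RSet VAL (NConst 0) (RConst 0) ;;
  RSet SURV (NConst 0) (RConst 1) ;;
  For POS RES scan_answer ;;
  If (RLe (rcell BEST) (rcell VAL)) store_answer Skip.

(** [BASE] holds the row offset [i * n], maintained by addition because indices cannot be
    multiplied. *)
Definition vec_at_elt : rexp := RGet VEC (NAdd (ncell BASE) (ncell ELT)).

(** The same pass updates [TOP] to a running maximum over the rows, which ends up as [f [set e]]. *)
Definition prepare_row : cmd :=
  For ELT SIZE
    (RSet QRY (ncell ELT) (RMul (RGet PROB (ncell ELT)) vec_at_elt) ;;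
     RSet DAMP (ncell ELT) (RConst 0) ;;
     If (RLe (RGet TOP (ncell ELT)) vec_at_elt)
       (RSet TOP (ncell ELT) vec_at_elt) Skip).

Definition prepare_threshold : cmd :=
  For ELT SIZE
    (If (RLe (RGet TOP (ncell OUTER)) (RGet TOP (ncell ELT)))
       (RSet QRY (ncell ELT)
          (RMul (RGet PROB (ncell ELT)) (RGet TOP (ncell ELT))) ;;
        RSet DAMP (ncell ELT) (RGet PROB (ncell ELT)))
       (RSet QRY (ncell ELT) (RConst 0) ;;
        RSet DAMP (ncell ELT) (RConst 0))).

(** [n] and [W] are moved away before array 0 is reused; zeroing its first cell stores the empty
    sequence as initial candidate, of score 0. *)
Definition probing_program : cmd :=
  NSet SIZE (NConst 0) (NGet OUT (NConst 0)) ;;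
  NSet WIDTH (NConst 0) (NGet OUT (NConst 1)) ;;
  NSet OUT (NConst 0) (NConst 0) ;;
  RSet BEST (NConst 0) (RConst 0) ;;
  NSet BASE (NConst 0) (NConst 0) ;;
  For ELT SIZE (RSet TOP (ncell ELT) (RConst 0)) ;;
  For OUTER WIDTH
    (prepare_row ;; try_candidate ;;
     NSet BASE (NConst 0) (NAdd (ncell BASE) (ncell SIZE))) ;;
  For OUTER SIZE (prepare_threshold ;; try_candidate).

Lemma drop_seq_code (n : nat) (l : seq 'I_n) (j : nat) : (j < size l)%N ->
  exists e, drop j l = e :: drop j.+1 l /\ nth 0%N (seq_code l) j.+1 = e.
Proof.
case: l => // x0 l jl; exists (nth x0 (x0 :: l) j); split.
  exact: drop_nth.
by rewrite -[LHS]/(nth 0%N [seq nat_of_ord e | e <- x0 :: l] j) (nth_map x0).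
Qed.

(** * Correctness of scoring and storing one oracle answer *)

Section Candidate.
Variables (R : realType) (n : nat) (orc : ('I_n -> R) -> seq 'I_n).
Variables (F : seq 'I_n -> Prop) (V : seq 'I_n -> R).
Implicit Types (s : state R) (q z : 'I_n -> R).

(** [BEST] is only a certified lower bound: for [V] the nonadaptive value, computing [V sigma] from
    its definition would sum over all subsets. *)
Definition best_stored s : Prop :=
  exists sigma, [/\ F sigma, output_state sigma s & rmem s BEST 0%N <= V sigma].

Lemma try_candidate_correct q z s :
  (forall e : 'I_n, rmem s QRY e = q e) ->
  (forall e : 'I_n, rmem s DAMP e = z e) ->
  F (orc q) -> uniq (orc q) -> score q z (orc q) <= V (orc q) ->
  best_stored s ->
  halts_with orc (10 + 7 * n) try_candidate s (fun s' =>
    [/\ best_stored s', rmem s BEST 0%N <= rmem s' BEST 0%N &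
        score q z (orc q) <= rmem s' BEST 0%N]).
Proof.
move=> sq sz Fl Ul Vl best; set l := orc q in Fl Ul Vl *.
(* A repetition-free answer has at most [n] entries, which bounds the scanning and copying loops. *)
have ln : (size l <= n)%N by have := max_card (mem l); rewrite (card_uniqP Ul) card_ord.
have eqq : (fun e : 'I_n => rmem s QRY e) = q by apply/funext.
apply: (@halts_with_weaken _ _ _ (1 + (1 + (1 + ((2 + size l * ((1 + 1) + 2)) +
   (1 + (1 + (2 + size l * (1 + 2)))).+1))))); [|by lia|by move=> s' H; exact: H].
apply: halts_with_seq; apply: halts_with_query.
set s1 := query_answer _ _ _ _.
have s1r : rmem s1 = rmem s by [].
have s1res k : (k <= size l)%N -> nmem s1 RES k = nth 0%N (seq_code l) k.
  by move=> kl; rewrite /s1 /= eqq -/l size_map ltnS kl.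
have s1o : nmem s1 OUT = nmem s OUT by [].
have {s1o} best1 : best_stored s1 by [].
move: s1 s1r s1res best1 => s1 s1r s1res best1.
apply: halts_with_seq; apply: halts_with_rset.
apply: halts_with_seq; apply: halts_with_rset.
set s2 := rset _ _ _ _.
have sz2 : nmem s2 RES 0%N = size l by rewrite /s2 /= s1res.
apply: halts_with_seq.
(* Value so far plus survival factor times the score of the unread suffix is invariant. *)
apply: (halts_with_for (I := fun j s' =>
   rmem s' VAL 0%N + rmem s' SURV 0%N * score q z (drop j l) = score q z l)) => //.
- by rewrite drop0 /s2 /= /upd /= add0r mul1r.
- move=> j s3 => jl s3j out Ij.
  have [e [dropE codeE]] := drop_seq_code jl.
  have res3 : nmem s3 RES j.+1 = e by rewrite (out.1 RES isT) /s2 /= s1res.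
  apply: halts_with_seq; apply: halts_with_rset; apply: halts_with_rset.
  rewrite /= /upd /= s3j addn1 res3.
  rewrite (out.2 QRY isT) (out.2 DAMP isT) /s2 /= /upd /= s1r sq sz.
  by rewrite -Ij dropE /=; ring.
move=> s3; rewrite drop_size /= mulr0 addr0 => val3 out.
have best3 : rmem s3 BEST = rmem s BEST.
  by rewrite (out.2 BEST isT) -s1r.
have out3 : nmem s3 OUT = nmem s1 OUT by rewrite (out.1 OUT isT).
have res3 k : (k <= size l)%N -> nmem s3 RES k = nth 0%N (seq_code l) k.
  by move=> kl; rewrite (out.1 RES isT) /s2 /= s1res.
apply: halts_with_if => /= cmp; last first.
  apply: (@halts_with_weaken _ _ _ 1); last by move=> s' H; exact: H.
    apply: halts_with_skip; rewrite best3; split=> //.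
      case: best1 => sigma [Fs os Vs]; exists sigma; split=> //.
        by move=> k kl; rewrite out3 os.
      by rewrite best3 -s1r.
    by move: cmp; rewrite best3 val3 -ltNge => /ltW.
  by lia.
apply: halts_with_seq; apply: halts_with_rset.
apply: halts_with_seq; apply: halts_with_nset.
set s4 := nset _ _ _ _.
have sz4 : nmem s4 RES 0%N = size l by rewrite /s4 /= /upd /= res3.
apply: (halts_with_for (I := fun j s' =>
   forall k, (k <= j)%N -> nmem s' OUT k = nth 0%N (seq_code l) k)) => //.
- by move=> k; rewrite leqn0 => /eqP ->; rewrite /s4 /= /upd /= res3.
- move=> j s5 => jl s5j out5 Ij; apply: halts_with_nset.
  move=> k kj; rewrite /= /upd /= s5j addn1; case: eqP => [->|kj1].
    by rewrite (out5.1 RES isT) /s4 /= /upd /= res3.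
  by apply: Ij; lia.
move=> s5 => out_l out5.
have best5 : rmem s5 BEST 0%N = score q z l.
  by rewrite (out5.2 BEST isT) /s4 /= /upd /= val3.
rewrite best5; split=> //.
  exists l; split=> //; last by rewrite best5.
  by move=> k; rewrite /= size_map ltnS => kl; exact: out_l.
by rewrite -val3 -best3.
Qed.

End Candidate.

(** * Correctness and running time of the whole program *)

Section Program.
Variables (R : realType) (n W : nat) (a : 'I_W -> 'I_n -> R).
Variables (f : {set 'I_n} -> R) (p : 'I_n -> R) (F : seq 'I_n -> Prop).
Variable orc : ('I_n -> R) -> seq 'I_n.
Hypotheses (xos : xos_representation a f) (p01 : activation_probability p).
Hypotheses (Fprobe : probing_constraint F) (orcP : linear_oracle F orc).
Implicit Types s : state R.

Let qsum i e := p e * a i e.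
Let qtop k e := if f [set k] <= f [set e] then p e * f [set e] else 0.
Let ztop k e := if f [set k] <= f [set e] then p e else 0.
Let stored := best_stored F (nonadaptive_value p f).

Definition instance_loaded s : Prop :=
  [/\ nmem s SIZE 0%N = n, nmem s WIDTH 0%N = W,
      forall e : 'I_n, rmem s PROB e = p e &
      forall (i : 'I_W) (e : 'I_n), rmem s VEC (i * n + e)%N = a i e].

Lemma instance_loaded_same_outside c s s' :
  same_outside c s s' -> [&& SIZE \notin nwrites c, WIDTH \notin nwrites c,
    PROB \notin rwrites c & VEC \notin rwrites c] ->
  instance_loaded s -> instance_loaded s'.
Proof.
move=> [N1 R1] /and4P[h1 h2 h3 h4] [sn sW sp sa].
by split=> [||e|i e]; rewrite ?(N1 _ h1, N1 _ h2, R1 _ h3, R1 _ h4).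
Qed.

Lemma prepare_row_correct (i : 'I_W) s :
  instance_loaded s -> nmem s BASE 0%N = (i * n)%N ->
  halts_with orc (2 + n * 6) prepare_row s (fun s' => forall e : 'I_n,
    [/\ rmem s' QRY e = qsum i e, rmem s' DAMP e = 0 &
        rmem s' TOP e = Num.max (rmem s TOP e) (a i e)]).
Proof.
move=> [sn sW sp sa] sbase.
rewrite -[6%N]/((1 + (1 + 2)) + 2)%N.
(* The second clause keeps the old [TOP] values at positions not yet reached, which the running
   maximum still has to read. *)
apply: (halts_with_for (I := fun j s' => forall e : 'I_n,
   ((e < j)%N -> [/\ rmem s' QRY e = qsum i e, rmem s' DAMP e = 0 &
        rmem s' TOP e = Num.max (rmem s TOP e) (a i e)]) /\
   ((j <= e)%N -> rmem s' TOP e = rmem s TOP e))) => //.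
- move=> j s1 => jn s1j out Ij.
  pose ej := Ordinal jn.
  have aE : rmem s1 VEC (nmem s1 BASE 0%N + j)%N = a i ej.
    by rewrite (out.2 VEC isT) (out.1 BASE isT) sbase -sa.
  have pE : rmem s1 PROB j = p ej by rewrite (out.2 PROB isT) -sp.
  have tE : rmem s1 TOP j = rmem s TOP j by exact: (Ij ej).2.
  apply: halts_with_seq; apply: halts_with_rset.
  apply: halts_with_seq; apply: halts_with_rset.
  have eqj (e : 'I_n) : (nat_of_ord e == j) = (e == ej) by [].
  apply: halts_with_if => /=; rewrite /upd /= s1j aE tE => cmp.
    apply: halts_with_rset => e /=; rewrite /upd /= s1j aE pE eqj.
    split=> [ej1|je].
      case: eqP => [->|ne]; first by split=> //; rewrite max_r.
      by apply: (Ij e).1; move: ne => /eqP; rewrite -eqj; lia.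
    case: eqP => [eE|ne]; first by move: je; rewrite eE /= ltnn.
    by apply: (Ij e).2; lia.
  apply: halts_with_skip => e /=; rewrite /upd /= ?s1j pE eqj.
  split=> [ej1|je]; last by apply: (Ij e).2; lia.
  case: eqP => [->|ne].
    by split=> //=; rewrite tE max_l // ltW // ltNge.
  by apply: (Ij e).1; move: ne => /eqP; rewrite -eqj; lia.
by move=> s' => H _ e; apply: (H e).1.
Qed.

Lemma prepare_threshold_correct (k : 'I_n) s :
  instance_loaded s -> nmem s OUTER 0%N = k ->
  (forall e : 'I_n, rmem s TOP e = f [set e]) ->
  halts_with orc (2 + n * 5) prepare_threshold s (fun s' => forall e : 'I_n,
    rmem s' QRY e = qtop k e /\ rmem s' DAMP e = ztop k e).
Proof.
move=> [sn sW sp sa] sk top.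
rewrite -[5%N]/((1 + 1).+1 + 2)%N.
apply: (halts_with_for (I := fun j s' => forall e : 'I_n,
   (e < j)%N -> rmem s' QRY e = qtop k e /\ rmem s' DAMP e = ztop k e)) => //.
- move=> j s1 => jn s1j out Ij.
  pose ej := Ordinal jn.
  have pE : rmem s1 PROB j = p ej by rewrite (out.2 PROB isT) -sp.
  have tE : rmem s1 TOP j = f [set ej] by rewrite (out.2 TOP isT) -top.
  have kE : rmem s1 TOP (nmem s1 OUTER 0%N) = f [set k].
    by rewrite (out.2 TOP isT) (out.1 OUTER isT) sk top.
  have eqj (e : 'I_n) : (nat_of_ord e == j) = (e == ej) by [].
  apply: halts_with_if => /=; rewrite s1j tE kE => cmp.
    apply: halts_with_seq; apply: halts_with_rset; apply: halts_with_rset.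
    move=> e ej1 /=; rewrite /upd /= s1j tE pE eqj /qtop /ztop.
    case: eqP => [->|ne]; first by rewrite cmp.
    by apply: Ij; move: ne => /eqP; rewrite -eqj; lia.
  apply: halts_with_seq; apply: halts_with_rset; apply: halts_with_rset.
  move=> e ej1 /=; rewrite /upd /= s1j eqj /qtop /ztop.
  case: eqP => [->|ne]; first by rewrite (negbTE cmp).
  by apply: Ij; move: ne => /eqP; rewrite -eqj; lia.
by move=> s' => H _ e; apply: H.
Qed.

Let a0 i e : 0 <= a i e. Proof. by case: xos. Qed.
Let p_ge0 e : 0 <= p e. Proof. by case/andP: (p01 e). Qed.

Lemma probing_program_correct s : input_state p a s ->
  halts_with orc (20 + n * 3 + W * (20 + 13 * n) + n * (20 + 12 * n))
    probing_program s (fun s' => exists sigma B,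
      [/\ F sigma, output_state sigma s', 0 <= B <= nonadaptive_value p f sigma,
          forall i, score (qsum i) (fun=> 0) (orc (qsum i)) <= B &
          forall k, score (qtop k) (ztop k) (orc (qtop k)) <= B]).
Proof.
move=> [sn sW sp sa].
have Uorc q : (forall e, 0 <= q e) -> F (orc q) /\ uniq (orc q).
  by move=> q0; have Fq := (orcP q0).1; split=> //; exact: Fprobe.1.
apply: (@halts_with_weaken _ _ _ (1 + (1 + (1 + (1 + (1 + ((2 + n * (1 + 2)) +
  ((2 + W * ((2 + n * 6) + ((10 + 7 * n) + 1) + 2)) +
   (2 + n * ((2 + n * 5) + (10 + 7 * n) + 2)))))))))); [|by lia|by move=> s' H; exact: H].
do 3 (apply: halts_with_seq; apply: halts_with_nset).
apply: halts_with_seq; apply: halts_with_rset.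
apply: halts_with_seq; apply: halts_with_nset.
set s1 := nset _ _ _ _.
have loaded1 : instance_loaded s1 by split.
have [n1 W1 _ _] := loaded1.
have stored1 : stored s1.
  exists [::]; split.
  - by apply: Fprobe.2 (prefix0s _) (orcP (fun=> lexx 0)).1.
  - by case.
  - rewrite /s1 /= /upd /=; apply: sumr_ge0 => A _.
    by rewrite mulr_ge0 ?active_prob_ge0 ?(xos_ge0 xos).
have best1 : rmem s1 BEST 0%N = 0 by [].
have base1 : nmem s1 BASE 0%N = 0%N by [].
move: s1 loaded1 n1 W1 stored1 best1 base1 => s1 loaded1 n1 W1 stored1 best1 base1.
apply: halts_with_seq.
apply: (halts_with_for (I := fun j s' => forall e : 'I_n,
   (e < j)%N -> rmem s' TOP e = 0)) => //.
  move=> j s2 => jn s2j out Ij; apply: halts_with_rset => e.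
  rewrite /= /upd /= s2j; case: eqP => // ne ej; apply: Ij; lia.
move=> s2 => top2 out2.
have loaded2 : instance_loaded s2.
  exact: (instance_loaded_same_outside out2 isT).
have [n2 W2 _ _] := loaded2.
have stored2 : stored s2.
  case: stored1 => sigma [Fs os Vs]; exists sigma; split=> //.
    by rewrite /output_state (out2.1 OUT isT).
  by rewrite (out2.2 BEST isT).
have best2 : rmem s2 BEST 0%N = 0 by rewrite (out2.2 BEST isT).
have base2 : nmem s2 BASE 0%N = 0%N by rewrite (out2.1 BASE isT).
move: {s1 loaded1 n1 W1 stored1 best1 base1 out2} s2 top2 loaded2 n2 W2 stored2 best2 base2.
move=> s2 top2 loaded2 n2 W2 stored2 best2 base2.
apply: halts_with_seq.
(* [TOP] stays between the processed rows and [f [set e]]; after the last row both bounds meet. *)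
apply: (halts_with_for (I := fun j s' =>
  [/\ stored s' /\ nmem s' BASE 0%N = (j * n)%N, 0 <= rmem s' BEST 0%N,
      forall e : 'I_n, 0 <= rmem s' TOP e <= f [set e],
      forall (i : 'I_W) (e : 'I_n), (i < j)%N -> a i e <= rmem s' TOP e &
      forall i : 'I_W, (i < j)%N ->
        score (qsum i) (fun=> 0) (orc (qsum i)) <= rmem s' BEST 0%N])) => //.
- split=> //; first by rewrite best2.
  by move=> e; rewrite top2 // lexx (xos_ge0 xos).
- move=> j s3 => jW s3j out3 [[stored3 base3] B3 top3 topge3 sc3].
  pose i := Ordinal jW.
  have loaded3 : instance_loaded s3.
    exact: (instance_loaded_same_outside out3 isT).
  apply: halts_with_seq.
  apply: halts_with_same_outside.
  apply: (halts_with_weaken (prepare_row_correct (i := i) loaded3 base3)) => //.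
  move=> s4 prep4 out4.
  have [Fi Ui] : F (orc (qsum i)) /\ uniq (orc (qsum i)).
    by apply: Uorc => e; rewrite mulr_ge0.
  apply: halts_with_seq; apply: halts_with_same_outside.
  apply: (halts_with_weaken (try_candidate_correct (q := qsum i) (z := fun=> 0)
     (V := nonadaptive_value p f) _ _ Fi Ui _ _)) => //.
  - by move=> e; case: (prep4 e).
  - by move=> e; case: (prep4 e).
  - exact: (score_sum_le_nonadaptive_value xos).
  - case: stored3 => sigma [Fs os Vs]; exists sigma; split=> //.
      by rewrite /output_state (out4.1 OUT isT).
    by rewrite (out4.2 BEST isT).
  move=> s5 [stored5 B45 Bi] out5; apply: halts_with_nset.
  have B35 : rmem s3 BEST 0%N <= rmem s5 BEST 0%N by rewrite -(out4.2 BEST isT).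
  have top5 (e : 'I_n) : rmem s5 TOP e = Num.max (rmem s3 TOP e) (a i e).
    by rewrite (out5.2 TOP isT); case: (prep4 e).
  split.
  + split=> //; rewrite /= /upd /= (out5.1 BASE isT) (out4.1 BASE isT) base3.
    rewrite (out5.1 SIZE isT) (out4.1 SIZE isT).
    by case: loaded3 => -> _ _ _; rewrite mulSn addnC.
  + exact: le_trans B35.
  + move=> e; rewrite /= top5; have /andP[t0 t1] := top3 e.
    by rewrite le_max t0 /= ge_max t1 (xos_ge_single xos).
  + move=> k e kj; rewrite /= top5 le_max.
    have [kj'|kj'] := ltnP k j; first by rewrite topge3.
    by rewrite (_ : k = i) ?lexx ?orbT //; apply: val_inj => /=; lia.
  + move=> k kj /=; have [kj'|kj'] := ltnP k j.
      by apply: le_trans B35; exact: sc3.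
    by rewrite (_ : k = i) //; apply: val_inj => /=; lia.
move=> s3 => -[[stored3 _] B3 top3 topge3 sc3] out3.
have {topge3} {}top3 (e : 'I_n) : rmem s3 TOP e = f [set e].
  have /andP[t0 t1] := top3 e; apply/le_anti; rewrite t1 /=.
  by apply: (xos_le xos) => // i; rewrite big_set1 topge3.
have loaded3 : instance_loaded s3.
  exact: (instance_loaded_same_outside out3 isT).
have [n3 _ _ _] := loaded3.
(* [BEST] never decreases, so it keeps dominating the row scores of the previous loop. *)
apply: (halts_with_for (I := fun j s' =>
  [/\ stored s', rmem s3 BEST 0%N <= rmem s' BEST 0%N &
      forall k : 'I_n, (k < j)%N ->
        score (qtop k) (ztop k) (orc (qtop k)) <= rmem s' BEST 0%N])) => //.
- move=> j s4 => jn s4j out4 [stored4 B4 sc4].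
  pose k := Ordinal jn.
  have loaded4 : instance_loaded s4.
    exact: (instance_loaded_same_outside out4 isT).
  apply: halts_with_seq; apply: halts_with_same_outside.
  apply: (halts_with_weaken (prepare_threshold_correct (k := k) loaded4 s4j _)) => //.
    by move=> e; rewrite (out4.2 TOP isT).
  move=> s5 prep5 out5.
  have [Fk Uk] : F (orc (qtop k)) /\ uniq (orc (qtop k)).
    by apply: Uorc => e; rewrite /qtop; case: ifP => // _; rewrite mulr_ge0 ?(xos_ge0 xos).
  apply: (halts_with_weaken (try_candidate_correct (q := qtop k) (z := ztop k)
     (V := nonadaptive_value p f) _ _ Fk Uk _ _)) => //.
  - by move=> e; case: (prep5 e).
  - by move=> e; case: (prep5 e).
  - exact: (score_first_le_nonadaptive_value xos).
  - case: stored4 => sigma [Fs os Vs]; exists sigma; split=> //.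
      by rewrite /output_state (out5.1 OUT isT).
    by rewrite (out5.2 BEST isT).
  move=> s6 [stored6 B56 Bk].
  have B46 : rmem s4 BEST 0%N <= rmem s6 BEST 0%N by rewrite -(out5.2 BEST isT).
  split=> //; first exact: le_trans B46.
  move=> l lj; have [lj'|lj'] := ltnP l j.
    by apply: le_trans B46; exact: sc4.
  by rewrite (_ : l = k) //; apply: val_inj => /=; lia.
move=> s4 => -[[sigma [Fs os Vs]] B4 sc4] _.
exists sigma, (rmem s4 BEST 0%N); split=> //.
- by rewrite Vs (le_trans B3 B4).
- by move=> i; apply: le_trans B4; exact: sc3.
- by move=> k; exact: sc4.
Qed.

End Program.

Theorem theorem4 (R : realType) :
  exists (prog : cmd) (d : nat) (c : R),
    0 < c /\
    forall (n W : nat) (a : 'I_W -> 'I_n -> R) (f : {set 'I_n} -> R)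
           (p : 'I_n -> R) (F : seq 'I_n -> Prop)
           (orc : ('I_n -> R) -> seq 'I_n) (s : state R),
      (0 < W)%N ->
      xos_representation a f ->
      activation_probability p ->
      probing_constraint F ->
      linear_oracle F orc ->
      input_state p a s ->
      exists (t : nat) (s' : state R) (sigma : seq 'I_n),
        [/\ exec orc prog s t s',
            (t <= d * (n + W) ^ d)%N,
            output_state sigma s',
            F sigma &
            c / log2_width R W * adaptive_opt F p f
              <= nonadaptive_value p f sigma].
Proof.
(* The factor [17^-1] inverts the constant of [adaptive_opt_le]; 100 is a generous choice, since the
   running time is quadratic in [n + W]. *)
exists probing_program, 100%N, 17^-1; split; first by rewrite invr_gt0.
move=> n W a f p F orc s W0 xos p01 Fprobe orcP input.
have [t [s' [E tT [sigma [B [Fs os /andP[B0 BV] Bsum Btop]]]]]] :=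
  probing_program_correct xos p01 Fprobe orcP input.
exists t, s', sigma; split=> //.
  apply: leq_trans tT _.
  have le_pow : ((n + W) ^ 2 <= (n + W) ^ 100)%N by rewrite leq_pexp2l //; lia.
  apply: leq_trans (leq_mul (leqnn 100) le_pow); rewrite expnS expn1; nia.
apply: le_trans BV.
have L1 : 1 <= log2_width R W by rewrite /log2_width le_max lexx.
have L0 : 0 < log2_width R W by exact: lt_le_trans L1.
have := adaptive_opt_le xos p01 Fprobe orcP Bsum Btop W0 B0.
by rewrite -invfM ler_pdivrMl ?mulr_gt0 // mulrAC.
Qed.
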